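(* Let $\Gamma$ be a finite simple connected graph with $d+1\ge 2$ distinct eigenvalues and predistance polynomials $p_i=\sum_{j=0}^i\omega_i^j x^j$, $i=0,\ldots,d$. Then its preintersection numbers $\alpha_i,\beta_i,\gamma_i$ are given by: (a) $\displaystyle \alpha_0=-\frac{\omega_1^0}{\omega_1^1}$, and $\displaystyle \alpha_i=\frac{\omega_i^{i-1}}{\omega_i^i}-\frac{\omega_{i+1}^i}{\omega_{i+1}^{i+1}}$ for $1\le i\le d-1$; (b) $\displaystyle \beta_i=\frac{\omega_{i+1}^{i-1}}{\omega_i^i}-\frac{\omega_{i+1}^i}{\omega_i^i}\left(\frac{\omega_{i+1}^i}{\omega_{i+1}^{i+1}}-\frac{\omega_{i+2}^{i+1}}{\omega_{i+2}^{i+2}}\right)-\frac{\omega_{i+1}^{i+1}}{\omega_{i+2}^{i+2}}\,\frac{\omega_{i+2}^i}{\omega_i^i}$ for $0\le i\le d-2$, where $\omega_1^{-1}=0$; (c) $\displaystyle \gamma_i=\frac{\omega_{i-1}^{i-1}}{\omega_i^i}$ for $1\le i\le d$.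
   Context: Let $A$ be the adjacency matrix of $\Gamma$, $n$ the number of vertices, $\lambda_0>\lambda_1>\cdots>\lambda_d$ the distinct eigenvalues of $A$, and $m_0,\ldots,m_d$ their multiplicities. The predistance polynomials $p_0,\ldots,p_d\in\mathbb{R}[x]$ are the unique polynomials with $\deg p_i=i$ that are orthogonal with respect to $\langle f,g\rangle_\Gamma=\frac1n\operatorname{tr}(f(A)g(A))=\frac1n\sum_{i=0}^d m_i f(\lambda_i)g(\lambda_i)$ and normalized so that $\|p_i\|_\Gamma^2=p_i(\lambda_0)$. The preintersection numbers $\alpha_i,\beta_i,\gamma_i$ considered are the coefficients of the three-term recurrence $xp_i=\beta_{i-1}p_{i-1}+\alpha_ip_i+\gamma_{i+1}p_{i+1}$, $i=0,\ldots,d$, with $\beta_{-1}=\gamma_{d+1}=0$ (for $i\le d-1$ an identity of polynomials; for $i=d$ an identity modulo the minimal polynomial $\prod_{i=0}^d(x-\lambda_i)$ of $A$). *)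

(* Defs.v *)
From HB Require Import structures.
From mathcomp Require Import all_boot all_order all_algebra.

Set Implicit Arguments.
Unset Strict Implicit.
Unset Printing Implicit Defensive.

Import Order.TTheory GRing.Theory Num.Theory.
Local Open Scope ring_scope.

Definition simple_graph (T : finType) (e : rel T) : Prop :=
  symmetric e /\ irreflexive e.

Definition connected_graph (T : finType) (e : rel T) : Prop :=
  forall x y : T, connect e x y.

(* The vertex set is 'I_n.+1, i.e. there are n.+1 vertices: horner_mx requires
   a size of this shape. *)
Definition adjacency (R : pzSemiRingType) (n : nat) (e : rel 'I_n.+1) :
    'M[R]_n.+1 :=
  \matrix_(i, j) (e i j)%:R.

(* lam lists the distinct eigenvalues lambda_0 > lambda_1 > ... > lambda_d. *)
Definition spectrum (R : rcfType) (n : nat) (A : 'M[R]_n.+1) (d : nat)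
    (lam : seq R) : Prop :=
  [/\ size lam = d.+1, sorted (fun x y => y < x) lam
    & forall x : R, (x \in lam) = eigenvalue A x].

Definition graph_dot (R : rcfType) (n : nat) (A : 'M[R]_n.+1)
    (f g : {poly R}) : R :=
  (n.+1)%:R^-1 * \tr (horner_mx A f *m horner_mx A g).

(* Only p 0, ..., p d are constrained; "size = i.+1" means degree i. *)
Definition predistance (R : rcfType) (n : nat) (A : 'M[R]_n.+1) (d : nat)
    (lam : seq R) (p : nat -> {poly R}) : Prop :=
  [/\ forall i, (i <= d)%N -> size (p i) = i.+1,
      forall i j, (i <= d)%N -> (j <= d)%N -> i <> j ->
        graph_dot A (p i) (p j) = 0
    & forall i, (i <= d)%N -> graph_dot A (p i) (p i) = (p i).[lam`_0]].

(* f_{i-1}, with the convention f_{-1} = 0 (i.-1 would give f 0 at i = 0). *)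
Definition prev_or0 (V : nmodType) (f : nat -> V) (i : nat) : V :=
  if i is k.+1 then f k else 0.

(* x p_i = beta_{i-1} p_{i-1} + alpha_i p_i + gamma_{i+1} p_{i+1}: an identity
   of polynomials for i < d, and modulo prod_i (x - lambda_i) for i = d, where
   the term in p_{d+1} disappears because gamma_{d+1} = 0. *)
Definition preintersection (R : rcfType) (d : nat) (lam : seq R)
    (p : nat -> {poly R}) (alpha beta gamma : nat -> R) : Prop :=
  let rhs i := prev_or0 (fun k => beta k *: p k) i + alpha i *: p i
               + gamma i.+1 *: p i.+1 in
  [/\ gamma d.+1 = 0,
      forall i, (i < d)%N -> 'X * p i = rhs i
    & \prod_(x <- lam) ('X - x%:P) %| 'X * p d - rhs d].

(* Main.v *)
Require Import Defs.
From mathcomp Require Import all_boot all_order all_algebra.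
From mathcomp Require Import ring.

Import Order.TTheory GRing.Theory Num.Theory.
Local Open Scope ring_scope.

(** The formulas come from comparing coefficients in the polynomial identities
    [x p_i = beta_{i-1} p_{i-1} + alpha_i p_i + gamma_{i+1} p_{i+1}], [i < d].
    Since [p_j] has degree [j], the coefficient of [x^{i+1}] on the right
    involves only [gamma_{i+1}], that of [x^i] only [gamma_{i+1}] and [alpha_i],
    and that of [x^{i-1}] all three.  The system is thus triangular, with the
    nonzero leading coefficients of the [p_j] on its diagonal, and [gamma_coef],
    [alpha_coef] and [beta_coef] solve it in this order. *)

Lemma coefXM_prev_or0 (R : nzSemiRingType) (q : {poly R}) (k : nat) :
  ('X * q)`_k = prev_or0 (fun j => q`_j) k.
Proof. by rewrite coefXM; case: k. Qed.

Lemma lead_coefS_neq0 (R : nzSemiRingType) (q : {poly R}) (k : nat) :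
  size q = k.+1 -> q`_k != 0.
Proof.
by move=> szq; rewrite -[k]/(k.+1.-1) -szq -lead_coefE lead_coef_eq0
  -size_poly_gt0 szq.
Qed.

Section Recurrence.

Set Implicit Arguments.
Unset Strict Implicit.

Variables (F : fieldType) (p : nat -> {poly F}) (alpha beta gamma : nat -> F).

(** A named form of the right-hand side of the recurrence, so that it can be
    assumed at a single index. *)
Definition three_term (i : nat) : {poly F} :=
  prev_or0 (fun k => beta k *: p k) i + alpha i *: p i + gamma i.+1 *: p i.+1.

Lemma coef_prev_term_ge (i k : nat) :
    (forall j, (j < i)%N -> size (p j) = j.+1) -> (i <= k)%N ->
  (prev_or0 (fun k => beta k *: p k) i)`_k = 0.
Proof.
case: i => [|i] szp lek /=; first by rewrite coef0.
by rewrite coefZ nth_default ?mulr0 // szp.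
Qed.

(** Comparison of the coefficients of [x^{i+1}], the leading ones. *)
Lemma gamma_coef (i : nat) :
    (forall j, (j <= i.+1)%N -> size (p j) = j.+1) ->
    'X * p i = three_term i ->
  gamma i.+1 = (p i)`_i / (p i.+1)`_i.+1.
Proof.
move=> szp /(congr1 (fun q : {poly F} => q`_i.+1)).
rewrite coefXM_prev_or0 /= 2!coefD !coefZ coef_prev_term_ge //; last first.
  by move=> j ltji; apply: szp; rewrite ltnW // ltnW.
rewrite [(p i)`_i.+1]nth_default ?szp // mulr0 !add0r => ->.
by rewrite mulfK // lead_coefS_neq0 // szp.
Qed.

(** Comparison of the coefficients of [x^i], with [gamma_{i+1}] known. *)
Lemma alpha_coef (i : nat) :
    (forall j, (j <= i.+1)%N -> size (p j) = j.+1) ->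
    'X * p i = three_term i ->
  alpha i = prev_or0 (fun k => (p i)`_k) i / (p i)`_i
            - (p i.+1)`_i / (p i.+1)`_i.+1.
Proof.
move=> szp rec; have Dgamma := gamma_coef szp rec.
have lead_i : (p i)`_i != 0 by rewrite lead_coefS_neq0 // szp.
have lead_iS : (p i.+1)`_i.+1 != 0 by rewrite lead_coefS_neq0 // szp.
move/(congr1 (fun q : {poly F} => q`_i)): rec.
rewrite coefXM_prev_or0 2!coefD !coefZ coef_prev_term_ge //; last first.
  by move=> j ltji; apply: szp; rewrite ltnW // ltnW.
by move=> ->; rewrite Dgamma; field; rewrite lead_i lead_iS.
Qed.

(** Comparison of the coefficients of [x^i] in the recurrence for [x p_{i+1}],
    the one in which [beta_i] occurs; [alpha_{i+1}] and [gamma_{i+2}] are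
    already known from the same recurrence. *)
Lemma beta_coef (i : nat) :
    (forall j, (j <= i.+2)%N -> size (p j) = j.+1) ->
    'X * p i.+1 = three_term i.+1 ->
  beta i = prev_or0 (fun k => (p i.+1)`_k) i / (p i)`_i
           - (p i.+1)`_i / (p i)`_i
             * ((p i.+1)`_i / (p i.+1)`_i.+1
                - (p i.+2)`_i.+1 / (p i.+2)`_i.+2)
           - (p i.+1)`_i.+1 / (p i.+2)`_i.+2 * ((p i.+2)`_i / (p i)`_i).
Proof.
move=> szp rec.
have Dgamma := gamma_coef szp rec; have Dalpha := alpha_coef szp rec.
have lead_i : (p i)`_i != 0 by rewrite lead_coefS_neq0 // szp // leqW.
have lead_iS : (p i.+1)`_i.+1 != 0 by rewrite lead_coefS_neq0 // szp.
have lead_iSS : (p i.+2)`_i.+2 != 0 by rewrite lead_coefS_neq0 // szp.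
move/(congr1 (fun q : {poly F} => q`_i)): rec.
rewrite coefXM_prev_or0 2!coefD !coefZ => ->.
by rewrite Dgamma Dalpha /=; field; rewrite lead_i lead_iS lead_iSS.
Qed.

End Recurrence.

Theorem proposition3p2 (R : rcfType) (n : nat) (e : rel 'I_n.+1)
    (d : nat) (lam : seq R) (p : nat -> {poly R})
    (alpha beta gamma : nat -> R)
    (e_simple : simple_graph e) (e_connected : connected_graph e)
    (d_gt0 : (0 < d)%N)
    (lamP : spectrum (adjacency R e) d lam)
    (pP : predistance (adjacency R e) d lam p)
    (abgP : preintersection d lam p alpha beta gamma) :
  [/\ alpha 0 = - ((p 1)`_0 / (p 1)`_1)
      /\ (forall i : nat, (1 <= i)%N -> (i <= d - 1)%N ->
            alpha i = (p i)`_i.-1 / (p i)`_i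
                      - (p i.+1)`_i / (p i.+1)`_i.+1),
      forall i : nat, (i + 2 <= d)%N ->
        beta i = prev_or0 (fun k => (p i.+1)`_k) i / (p i)`_i
                 - (p i.+1)`_i / (p i)`_i
                   * ((p i.+1)`_i / (p i.+1)`_i.+1
                      - (p i.+2)`_i.+1 / (p i.+2)`_i.+2)
                 - (p i.+1)`_i.+1 / (p i.+2)`_i.+2
                   * ((p i.+2)`_i / (p i)`_i)
    & forall i : nat, (1 <= i)%N -> (i <= d)%N ->
        gamma i = (p i.-1)`_i.-1 / (p i)`_i].
Proof.
have [szp _ _] := pP; have [_ rec _] := abgP.
have szp_le k : (k <= d)%N -> forall j, (j <= k)%N -> size (p j) = j.+1.
  by move=> lekd j lejk; apply: szp; apply: leq_trans lekd.
split; first split.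
- by rewrite (alpha_coef (szp_le _ d_gt0) (rec _ d_gt0)) /= mul0r sub0r.
- case=> [//|i] _ lei; have lti : (i.+1 < d)%N by rewrite -(subnK d_gt0) addn1.
  by rewrite (alpha_coef (szp_le _ lti) (rec _ lti)).
- by move=> i; rewrite addn2 => lti; apply: beta_coef (szp_le _ lti) (rec _ lti).
- by case=> [//|i] _ lti; apply: gamma_coef (szp_le _ lti) (rec _ lti).
Qed.
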